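(* In the setting described in the context (a simple algebraic extension $(L|K,v)$ with $vL=vK$, a complete sequence of key polynomials $\{Q_i(\eta)\}_{i\in I}$ for it, and the associated final segments $\alpha,\beta$ of $\Gamma_\infty$), assume that the $\mathcal{O}_L$-module homomorphism $\Omega\to I_\alpha/I_\beta$ sending $d\tilde Q_i(\eta)$ to $Q_i'(\eta)/a_i+I_\beta$ for $i\in I$ is an isomorphism, and assume that $\Omega\ne(0)$. Then $\Omega$ is finitely presented as an $\mathcal{O}_L$-module if and only if each of $\alpha$ and $\beta$ has a smallest element.
   Context: Let $(L|K,v)$ be a simple algebraic extension of valued fields with $vL=vK$, written $L=K(\eta)$, and let $g\in K[x]$ be the minimal polynomial of $\eta$ over $K$. $\mathcal{O}_L,\mathcal{O}_K$ are the valuation rings, $\Gamma=vL$, $\Gamma_\infty=\Gamma\cup\{\infty\}$, and $\Omega$ is the $\mathcal{O}_L$-module of Kähler differentials of $\mathcal{O}_L|\mathcal{O}_K$. For $S\subseteq\Gamma_\infty$, $I_S=\{b\in L\mid \exists s\in S:\ vb\ge s\}$, an $\mathcal{O}_L$-submodule of $L$ (with $I_\emptyset=\{0\}$). Let $\nu(f)=v(f(\eta))$ for $f\in K[x]$; fix an extension of $\nu$ to $\overline K[x]$, again denoted $\nu$. For $f\in K[x]\setminus K$ put $\delta(f)=\max\{\nu(x-a)\mid f(a)=0\}$. A monic polynomial $Q\in K[x]\setminus K$ is a key polynomial for $\nu$ if for every $f\in K[x]\setminus K$, $\delta(f)\ge\delta(Q)$ implies $\deg f\ge\deg Q$. For non-constant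 $q$ and $q$-expansion $f=f_0+\ldots+f_rq^r$ ($\deg f_\ell<\deg q$), $\nu_q(f)=\min_\ell\nu(f_\ell q^\ell)$. A set of non-constant polynomials is complete for $\nu$ if for every non-constant $f\in K[x]$ it contains some $q$ with $\deg q\le\deg f$ and $\nu_q(f)=\nu(f)$. Let $\{Q_i\}_{i\in I}\cup\{g\}$ be a complete set of key polynomials for $\nu$, with $I$ well-ordered with initial element $0$, $i<j\Rightarrow\delta(Q_i)<\delta(Q_j)$, $\nu(Q_i)<\infty$ for all $i\in I$, $Q_0=x$ and $\nu(x)=0$ (one then says $\{Q_i(\eta)\}_{i\in I}$ is a complete sequence of key polynomials for $(L|K,v)$). For each $i\in I$ choose $a_i\in K$ with $v(a_i)=\nu(Q_i)$ (with $a_0=1$) and put $\tilde Q_i=Q_i/a_i$. With $f'$ the formal derivative, put $\alpha_i=\nu(Q_i')-\nu(Q_i)$ and $\beta_i=\nu(g')-\nu_{Q_i}(g)$ in $\Gamma_\infty$, and let $\alpha$, $\beta$ be the smallest final segments of $\Gamma_\infty$ containing $\{\alpha_i\mid i\in I\}$ and $\{\beta_i\mid i\in I\}$, respectively. *)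

(* Defs.v *)
From HB Require Import structures.
From mathcomp Require Import all_boot all_order all_algebra all_field.
From mathcomp Require Import boolp classical_sets.
From mathcomp Require Import generic_quotient ring_quotient.
From mathcomp.multinomials Require Import monalg.

Set Implicit Arguments.
Unset Strict Implicit.
Unset Printing Implicit Defensive.

Import Order.TTheory GRing.Theory Num.Theory.
Local Open Scope ring_scope.
Local Open Scope quotient_scope.

(* Totality is a field here: joining with [Order.Total] instead would clash
   with the numeric hierarchy, which already contains that join. *)
HB.mixin Record POrderedZmodule_isOrderedGroup G of Num.POrderedZmodule G := {
  ogrp_le_total : total (<=%R : rel G);
  ogrp_leD2r : forall z x y : G, x <= y -> x + z <= y + z
}.

#[short(type="orderedGroupType")]
HB.structure Definition OrderedGroup :=
  { G of Num.POrderedZmodule G & POrderedZmodule_isOrderedGroup G }.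

HB.instance Definition _ (G : orderedGroupType) :=
  Order.POrder_isTotal.Build ring_display (OrderedGroup.sort G)
    (@ogrp_le_total G).

Definition winf (G : Type) : Type := option G.
Definition fin {G : Type} (c : G) : winf G := Some c.
Definition infty {G : Type} : winf G := None.
Definition winf_map {G H : Type} (f : G -> H) : winf G -> winf H := omap f.

Section WInf.
Variable G : orderedGroupType.
Implicit Types x y z : winf G.

HB.instance Definition _ := Choice.copy (winf G) (option G).

Definition winf_add x y : winf G :=
  if x is Some a then if y is Some b then Some (a + b) else None else None.

(* The difference only makes sense for finite [y]; it is infinite if [x] is,
   and [x - oo] is a junk value. *)
Definition winf_sub x y : winf G :=
  if x is Some a then if y is Some b then Some (a - b) else None else None.

Definition winf_le x y : bool :=
  if y is Some b then if x is Some a then a <= b else false else true.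

Definition winf_lt x y : bool := (y != x) && winf_le x y.

Lemma winf_addA : associative winf_add.
Proof. by move=> [a|] [b|] [c|] //=; rewrite addrA. Qed.

Lemma winf_addC : commutative winf_add.
Proof. by move=> [a|] [b|] //=; rewrite addrC. Qed.

Lemma winf_add0 : left_id (Some 0 : winf G) winf_add.
Proof. by move=> [a|] //=; rewrite add0r. Qed.

HB.instance Definition _ :=
  GRing.isNmodule.Build (winf G) winf_addA winf_addC winf_add0.

Lemma winf_le_anti : antisymmetric winf_le.
Proof. by move=> [a|] [b|] //= h; rewrite (le_anti h). Qed.

Lemma winf_le_trans : transitive winf_le.
Proof. by move=> [b|] [a|] [c|] //=; apply: le_trans. Qed.

Lemma winf_le_total : total winf_le.
Proof. by move=> [a|] [b|] //=; apply: le_total. Qed.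

HB.instance Definition _ := Order.isOrder.Build ring_display (winf G)
  (fun x y => erefl : winf_lt x y = (y != x) && winf_le x y)
  (fun x y => erefl) (fun x y => erefl)
  winf_le_anti winf_le_trans winf_le_total.

Lemma winf_leE x y : (x <= y) = winf_le x y. Proof. by []. Qed.

Lemma winf_addE x y : x + y = winf_add x y. Proof. by []. Qed.

Lemma winf_leD2r z x y : x <= y -> x + z <= y + z.
Proof.
rewrite !winf_leE !winf_addE.
by case: x y z => [a|] [b|] [c|] //=; apply: ogrp_leD2r.
Qed.

Lemma winf_addr_ge0 x y :
  (0 : winf G) <= x -> (0 : winf G) <= y -> (0 : winf G) <= x + y.
Proof.
move=> x0 y0; apply: le_trans y0 _.
by rewrite -[leLHS]add0r; apply: winf_leD2r.
Qed.

Definition final_segment : set (set (winf G)) :=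
  [set S | forall s t, S s -> s <= t -> S t].

End WInf.

(* A valuation on a commutative ring takes the value [infty] on a prime ideal,
   possibly nonzero; on a field it is finite outside 0, because
   [0 = v x + v x^-1] for [x != 0]. *)
Record valuation (R : comNzRingType) (G : orderedGroupType) := Valuation {
  valuation_fun :> R -> winf G;
  valuation0 : valuation_fun 0 = infty;
  valuation1 : valuation_fun 1 = 0;
  valuationM : forall x y, valuation_fun (x * y) = valuation_fun x + valuation_fun y;
  valuationD : forall x y, Order.min (valuation_fun x) (valuation_fun y) <= valuation_fun (x + y)
}.

Arguments valuation0 {R G} v : rename.
Arguments valuation1 {R G} v : rename.
Arguments valuationM {R G} v x y : rename.
Arguments valuationD {R G} v x y : rename.

Section Comap.
Variables (R S : comNzRingType) (G : orderedGroupType).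
Variables (f : {rmorphism R -> S}) (v : valuation S G).

Lemma comap_val0 : v (f 0) = infty. Proof. by rewrite rmorph0 valuation0. Qed.
Lemma comap_val1 : v (f 1) = 0. Proof. by rewrite rmorph1 valuation1. Qed.
Lemma comap_valM x y : v (f (x * y)) = v (f x) + v (f y).
Proof. by rewrite rmorphM valuationM. Qed.
Lemma comap_valD x y : Order.min (v (f x)) (v (f y)) <= v (f (x + y)).
Proof. by rewrite rmorphD valuationD. Qed.

Definition comap : valuation R G :=
  @Valuation R G (fun x => v (f x)) comap_val0 comap_val1 comap_valM comap_valD.

End Comap.

Section ValuationRing.
Variables (R : comNzRingType) (G : orderedGroupType) (v : valuation R G).

Lemma valuationN x : v (- x) = v x.
Proof.
have h1 : v (-1) = 0.
  have : v (-1) + v (-1) = 0 by rewrite -valuationM mulrNN mulr1 valuation1.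
  rewrite winf_addE; case: (v (-1)) => [c|] //= [cc0]; congr Some.
  have [c0|c0] := leP c 0.
    apply: le_anti; rewrite c0 /= -cc0 -[leRHS]add0r.
    exact: ogrp_leD2r.
  apply: le_anti; rewrite (ltW c0) andbT -cc0 -[leLHS]add0r.
  by apply: ogrp_leD2r; apply: ltW.
by rewrite -mulN1r valuationM h1 add0r.
Qed.

Definition valring_pred : {pred R} := fun x => (0 : winf G) <= v x.

Lemma valring_predP x : (x \in valring_pred) = ((0 : winf G) <= v x).
Proof. by []. Qed.

Lemma valring_closed : subring_closed valring_pred.
Proof.
split=> [|x y|x y]; rewrite !valring_predP ?valuation1 // => hx hy.
  by apply: le_trans (valuationD _ _ _); rewrite valuationN le_min hx.
by rewrite valuationM winf_addr_ge0.
Qed.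

HB.instance Definition _ :=
  GRing.isSubringClosed.Build R valring_pred valring_closed.

Record valring : predArgType :=
  Valring { valring_val : R; valringP : valring_val \in valring_pred }.

HB.instance Definition _ := [isSub for valring_val].
HB.instance Definition _ := [Choice of valring by <:].
HB.instance Definition _ := [SubChoice_isSubComNzRing of valring by <:].

End ValuationRing.


Section ValringMap.
Variables (R S : comNzRingType) (G : orderedGroupType).
Variables (f : {rmorphism R -> S}) (v : valuation S G).

Definition valring_map (x : valring (comap f v)) : valring v :=
  Valring (valringP x : f (val x) \in valring_pred v).

Lemma valring_map_zmod : zmod_morphism valring_map.
Proof. by move=> x y; apply: val_inj; rewrite /= !rmorphB. Qed.

Lemma valring_map_monoid : monoid_morphism valring_map.
Proof. by split=> [|x y]; apply: val_inj; rewrite /= ?rmorph1 ?rmorphM. Qed.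

HB.instance Definition _ :=
  GRing.isZmodMorphism.Build _ _ valring_map valring_map_zmod.
HB.instance Definition _ :=
  GRing.isMonoidMorphism.Build _ _ valring_map valring_map_monoid.

End ValringMap.

Arguments valring_map {R S G} f v x.

Section QuotMod.
Variables (R : comNzRingType) (M : lmodType R) (N : submodClosed M).

(* [submodClosed] does not register closure under opposites, which
   [Quotient.quot] asks for. *)
Definition quotmod_pred : {pred M} := fun x => x \in N.

Lemma quotmod_pred_closed : zmod_closed quotmod_pred.
Proof.
split=> [|x y hx hy]; first exact: (rpred0 N).
by rewrite -scaleN1r; apply: (rpredD (S := N)) => //; exact: (@rpredZ R M N).
Qed.

HB.instance Definition _ :=
  GRing.isZmodClosed.Build M quotmod_pred quotmod_pred_closed.

Definition quotmod : Type := Quotient.quot quotmod_pred.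
HB.instance Definition _ := GRing.Zmodule.on quotmod.

Definition quotmod_pi (x : M) : quotmod := \pi_(Quotient.quot quotmod_pred) x.

Lemma quotmod_pi_surj (q : quotmod) : exists x, quotmod_pi x = q.
Proof. by exists (repr (q : Quotient.quot quotmod_pred)); apply: reprK. Qed.

Lemma quotmod_piP (x y : M) :
  reflect (quotmod_pi x = quotmod_pi y) (x - y \in N).
Proof.
rewrite -[_ \in N]/(x - y \in quotmod_pred) Quotient.idealrBE.
exact: eqP.
Qed.

Lemma quotmod_piD : {morph quotmod_pi : x y / x + y}.
Proof. exact: (raddfD \pi_(Quotient.quot quotmod_pred)). Qed.

Definition quotmod_scale (a : R) (q : quotmod) : quotmod :=
  quotmod_pi (a *: repr (q : Quotient.quot quotmod_pred)).

Lemma quotmod_scaleE a x : quotmod_scale a (quotmod_pi x) = quotmod_pi (a *: x).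
Proof.
apply/quotmod_piP; rewrite -scalerBr; apply: (@rpredZ R M N).
by apply/quotmod_piP; apply: reprK.
Qed.

Lemma quotmod_scaleA a b q :
  quotmod_scale a (quotmod_scale b q) = quotmod_scale (a * b) q.
Proof. by have [x <-] := quotmod_pi_surj q; rewrite !quotmod_scaleE scalerA. Qed.

Lemma quotmod_scale1 : left_id 1 quotmod_scale.
Proof.
by move=> q; have [x <-] := quotmod_pi_surj q; rewrite quotmod_scaleE scale1r.
Qed.

Lemma quotmod_scaleDr : right_distributive quotmod_scale +%R.
Proof.
move=> a p q; have [x <-] := quotmod_pi_surj p; have [y <-] := quotmod_pi_surj q.
by rewrite -quotmod_piD !quotmod_scaleE scalerDr quotmod_piD.
Qed.

Lemma quotmod_scaleDl q :
  {morph (fun a => quotmod_scale a q) : a b / a + b >-> a + b}.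
Proof.
have [x <-] := quotmod_pi_surj q => a b.
by rewrite !quotmod_scaleE scalerDl quotmod_piD.
Qed.

HB.instance Definition _ := GRing.Zmodule_isLmodule.Build R quotmod
  quotmod_scaleA quotmod_scale1 quotmod_scaleDr quotmod_scaleDl.

Lemma quotmod_pi_linear : linear quotmod_pi.
Proof. by move=> a x y; rewrite quotmod_piD -quotmod_scaleE. Qed.

HB.instance Definition _ :=
  GRing.isLinear.Build R M quotmod _ quotmod_pi quotmod_pi_linear.

End QuotMod.

(* Exactness of R^m -> R^n -> M -> 0, where A is the matrix of the first map. *)
Definition finitely_presented (R : comNzRingType) (M : lmodType R) : Prop :=
  exists (m n : nat) (A : 'M[R]_(m, n)) (f : {linear 'rV[R]_n -> M}),
    (forall w : M, exists x, f x = w) /\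
    (forall x, f x = 0 <-> exists y : 'rV[R]_m, x = y *m A).

(* The quotient of the free B-module {malg B[B]} on symbols << b >>, b in B,
   by the submodule generated by the relations of an A-linear derivation. *)
Section Kahler.
Variables (A B : comNzRingType) (f : {rmorphism A -> B}).

Inductive kahler_relation : {malg B[B]} -> Prop :=
| kahler_relD x y : kahler_relation (<< x + y >> - << x >> - << y >>)
| kahler_relM x y :
    kahler_relation (<< x * y >> - x *: << y >> - y *: << x >>)
| kahler_relC a : kahler_relation << f a >>
| kahler_rel0 : kahler_relation 0
| kahler_relP b u w :
    kahler_relation u -> kahler_relation w -> kahler_relation (b *: u + w).

Definition kahler_pred : {pred {malg B[B]}} := fun u => `[< kahler_relation u >].

Lemma kahler_closed : submod_closed kahler_pred.
Proof.
split=> [|b u w /asboolP hu /asboolP hw]; apply/asboolP.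
  exact: kahler_rel0.
exact: kahler_relP.
Qed.

HB.instance Definition _ :=
  GRing.isSubmodClosed.Build B {malg B[B]} kahler_pred kahler_closed.

Definition kahler : Type := quotmod kahler_pred.
HB.instance Definition _ := GRing.Lmodule.on kahler.

Definition kahler_d (b : B) : kahler := quotmod_pi kahler_pred << b >>.

End Kahler.

(* R seen as a module over its valuation ring. *)
Definition valmod (R : comNzRingType) (G : orderedGroupType)
  (v : valuation R G) : Type := R.

Section SegmentModules.
Variables (R : comNzRingType) (G : orderedGroupType) (v : valuation R G).

HB.instance Definition _ := GRing.Zmodule.on (valmod v).

Definition valmod_scale (a : valring v) (x : valmod v) : valmod v :=
  valring_val a * (x : R).

Lemma valmod_scaleA a b x :
  valmod_scale a (valmod_scale b x) = valmod_scale (a * b) x.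
Proof. exact: mulrA. Qed.
Lemma valmod_scale1 : left_id 1 valmod_scale.
Proof. by move=> x; exact: mul1r. Qed.
Lemma valmod_scaleDr : right_distributive valmod_scale +%R.
Proof. by move=> a x y; exact: mulrDr. Qed.
Lemma valmod_scaleDl x :
  {morph (fun a => valmod_scale a x) : a b / a + b >-> a + b}.
Proof. by move=> a b; exact: mulrDl. Qed.

HB.instance Definition _ := GRing.Zmodule_isLmodule.Build (valring v) (valmod v)
  valmod_scaleA valmod_scale1 valmod_scaleDr valmod_scaleDl.

(* The disjunct [b = 0] only matters for S empty. *)
Definition seg_pred (S : set (winf G)) : {pred valmod v} :=
  fun b => `[< b = 0 \/ exists2 s, S s & s <= v b >].

Lemma seg_predP (S : set (winf G)) (b : valmod v) :
  reflect (b = 0 \/ exists2 s, S s & s <= v b) (b \in seg_pred S).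
Proof. exact: asboolP. Qed.

Lemma seg_closed S : submod_closed (seg_pred S).
Proof.
split=> [|a x y]; first by apply/seg_predP; left.
have vZ (z : valmod v) : v z <= v (a *: z).
  rewrite [X in _ <= v X]/(_ * _) valuationM -[leLHS]add0r.
  exact/winf_leD2r/(valringP a).
case/seg_predP=> [->|[s Ss sx]]; first by rewrite scaler0 add0r.
case/seg_predP=> [->|[t St ty]].
  by rewrite addr0; apply/seg_predP; right; exists s => //; apply: le_trans (vZ _).
apply/seg_predP; right; exists (Order.min s t).
  by rewrite /Order.min; case: ifP.
apply: le_trans (valuationD _ _ _); rewrite le_min !ge_min ty orbT andbT.
by rewrite (le_trans sx (vZ _)).
Qed.

HB.instance Definition _ S :=
  GRing.isSubmodClosed.Build (valring v) (valmod v) (seg_pred S) (seg_closed S).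

Record seg_mod (S : set (winf G)) : predArgType :=
  SegMod { seg_val : valmod v; seg_valP : seg_val \in seg_pred S }.

HB.instance Definition _ S := [isSub for @seg_val S].
HB.instance Definition _ S := [Choice of seg_mod S by <:].
HB.instance Definition _ S := [SubChoice_isSubLmodule of seg_mod S by <:].

Definition seg_sub_pred (S T : set (winf G)) : {pred seg_mod S} :=
  fun x => seg_val x \in seg_pred T.

Lemma seg_sub_closed S T : submod_closed (@seg_sub_pred S T).
Proof.
split=> [|a x y hx hy]; first exact: (rpred0 (seg_pred T)).
exact: (rpredD (rpredZ a hx) hy).
Qed.

HB.instance Definition _ S T := GRing.isSubmodClosed.Build (valring v)
  (seg_mod S) (@seg_sub_pred S T) (@seg_sub_closed S T).

(* I_S / (I_S \cap I_T), which is I_S / I_T as soon as I_T is contained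
   in I_S. *)
Definition seg_quot (S T : set (winf G)) : Type := quotmod (@seg_sub_pred S T).
HB.instance Definition _ S T := GRing.Lmodule.on (seg_quot S T).

Definition seg_pi (S T : set (winf G)) (x : seg_mod S) : seg_quot S T :=
  quotmod_pi (@seg_sub_pred S T) x.

End SegmentModules.

Arguments valmod {R G} v.
Arguments seg_pred {R G} v S.
Arguments seg_mod {R G} v S.
Arguments seg_quot {R G} v S T.
Arguments seg_pi {R G v S} T x.

Section Expansion.
Variable K : fieldType.
Implicit Types f q : {poly K}.

(* The coefficient of q^l in the q-expansion of f. *)
Definition qdigit q f (l : nat) : {poly K} := (f %/ q ^+ l) %% q.

Lemma size_qdigit q f l : (1 < size q)%N -> (size (qdigit q f l) < size q)%N.
Proof. by move=> q1; rewrite ltn_modp -size_poly_gt0; case: size q1. Qed.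

Lemma qexpansion q f : (1 < size q)%N ->
  f = \sum_(l < size f) qdigit q f l * q ^+ l.
Proof.
move=> q1; have q0 : q != 0 by rewrite -size_poly_gt0; case: size q1.
have H n : f = \sum_(l < n) qdigit q f l * q ^+ l + f %/ q ^+ n * q ^+ n.
  elim: n => [|n IH]; first by rewrite big_ord0 add0r expr0 divp1 mulr1.
  rewrite {1}IH big_ord_recr /= -addrA; congr (_ + _).
  rewrite {1}(divp_eq (f %/ q ^+ n) q) mulrDl addrC -/(qdigit q f n).
  by rewrite -mulrA -exprS exprSr divp_divl.
rewrite {1}(H (size f)) [X in _ + X * _]divp_small ?mul0r ?addr0 //.
rewrite -(prednK (n := size (q ^+ _))); last first.
  by rewrite size_poly_gt0 expf_neq0.
by rewrite size_exp ltnS leq_pmull // -ltnS (ltn_predK q1).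
Qed.

Variables (G : orderedGroupType) (nu : valuation {poly K} G).

Definition nu_trunc q f : winf G :=
  \big[Order.min/infty]_(l < size f) nu (qdigit q f l * q ^+ l).

Definition complete_set (S : set {poly K}) : Prop :=
  (forall q, S q -> (1 < size q)%N) /\
  forall f, (1 < size f)%N ->
    exists q, [/\ S q, (size q <= size f)%N & nu_trunc q f = nu f].

End Expansion.

Section KeyPolynomial.
Variables (K : fieldType) (Kbar : closedFieldType).
Variables (iota : {rmorphism K -> Kbar}).
Variables (G : orderedGroupType) (nubar : valuation {poly Kbar} G).
Implicit Types f q : {poly K}.

Definition roots_in_closure f : seq Kbar :=
  sval (closed_field_poly_normal (map_poly iota f)).

(* Starting the maximum from the first root makes it a maximum over the roots
   exactly, when there is one. *)
Definition delta f : winf G :=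
  let r := roots_in_closure f in
  \big[Order.max/nubar ('X - (head 0 r)%:P)]_(z <- r) nubar ('X - z%:P).

Lemma deltaP f : (1 < size f)%N ->
  (exists2 z, root (map_poly iota f) z & delta f = nubar ('X - z%:P)) /\
  (forall z, root (map_poly iota f) z -> nubar ('X - z%:P) <= delta f).
Proof.
move=> f1; have f0 : map_poly iota f != 0.
  by rewrite map_poly_eq0 -size_poly_gt0; case: size f1.
have rE z : (z \in roots_in_closure f) = root (map_poly iota f) z.
  rewrite /roots_in_closure; case: closed_field_poly_normal => r /= ->.
  by rewrite rootZ ?lead_coef_eq0 // root_prod_XsubC.
have rN0 : roots_in_closure f != [::].
  have /closed_rootP[z] : size (map_poly iota f) != 1%N.
    by rewrite size_map_poly; case: size f1 => [|[]].
  by rewrite -rE; case: roots_in_closure.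
have hd : head 0 (roots_in_closure f) \in roots_in_closure f.
  by case: roots_in_closure rN0 => //= z r _; rewrite inE eqxx.
split=> [|z]; last by rewrite -rE /delta => zr; exact: (le_bigmax_seq _ _ predT _ zr).
rewrite /delta big_seq; elim/big_ind: _ => [|x y [a ? ->] [b ? ->]|z zr].
- by exists (head 0 (roots_in_closure f)); rewrite -?rE.
- by rewrite /Order.max; case: ifP => _; [exists b | exists a].
- by exists z; rewrite -?rE.
Qed.

Definition key_polynomial q : Prop :=
  [/\ q \is monic, (1 < size q)%N &
      forall f, (1 < size f)%N -> delta q <= delta f -> (size q <= size f)%N].

End KeyPolynomial.

Section KeySequence.
Variables (K : fieldType) (L : fieldExtType K) (G : orderedGroupType).
Variables (v : valuation L G) (eta : L).

Definition nu : valuation {poly K} G := comap (horner_alg eta) v.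

(* The Kähler differentials of O_L over O_K. *)
Definition Omega : Type := kahler (valring_map (in_alg L) v).
HB.instance Definition _ := GRing.Lmodule.on Omega.

Definition Omega_d (b : valring v) : Omega :=
  kahler_d (valring_map (in_alg L) v) b.

Section Segments.
Variables (I : Type) (Q : I -> {poly K}) (g : {poly K}).

Definition alpha : set (winf G) := smallest (@final_segment G)
  (range (fun i => winf_sub (nu (Q i)^`()) (nu (Q i)))).

Definition beta : set (winf G) := smallest (@final_segment G)
  (range (fun i => winf_sub (nu g^`()) (nu_trunc nu (Q i) g))).

Lemma alpha_seg_subproof (a : I -> K) i :
  v (a i)%:A = nu (Q i) -> nu (Q i) < infty ->
  (horner_alg eta (Q i)^`() / (a i)%:A : valmod v) \in seg_pred v alpha.
Proof.
move=> va fin_i; apply/seg_predP; right.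
exists (winf_sub (nu (Q i)^`()) (nu (Q i))).
  by move=> S [_ sub]; apply: sub; exists i.
have ai0 : (a i)%:A != 0 :> L.
  by apply: contraTneq fin_i => a0; rewrite -va a0 valuation0 ltxx.
have := valuationM v (horner_alg eta (Q i)^`() / (a i)%:A) (a i)%:A.
rewrite divfK // va; move: fin_i; rewrite -[v (horner_alg eta _)]/(nu _).
case: (nu (Q i)) => [c|] // _; rewrite winf_addE.
by case: (v (_ / _)) => [d|] ->; rewrite //= /winf_sub /= addrK.
Qed.

End Segments.

Section Elements.
Variables (q : {poly K}) (a : K).
Hypotheses (va : v a%:A = nu q) (fin_q : nu q < infty).

Lemma key_elt_subproof : horner_alg eta (a^-1 *: q) \in valring_pred v.
Proof.
rewrite valring_predP.
have a0 : a%:A != 0 :> L.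
  by apply: contraTneq fin_q => a0; rewrite -va a0 valuation0 ltxx.
have := valuationM v (horner_alg eta (a^-1 *: q)) a%:A.
have -> : horner_alg eta (a^-1 *: q) * a%:A = horner_alg eta q.
  have aV : (a^-1)%:A * a%:A = 1 :> L.
    rewrite mulr_algl scalerA mulVf ?scale1r //.
    by apply: contraNneq a0 => ->; rewrite scale0r.
  by rewrite -mul_polyC rmorphM /= horner_algC mulrAC aV mul1r.
rewrite va -[v (horner_alg eta q)]/(nu q); move: fin_q.
case: (nu q) => [c|] // _; rewrite winf_addE.
case: (v _) => [d|] //= [] /eqP; rewrite eq_sym -subr_eq0 addrK => /eqP ->.
exact: lexx.
Qed.

(* The element (q / a)(eta) of O_L, where v a = nu q. *)
Definition key_elt : valring v := Valring key_elt_subproof.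

End Elements.

(* The element Q_i'(eta) / a_i of I_alpha. *)
Definition key_deriv_elt (I : Type) (Q : I -> {poly K}) (a : I -> K) (i : I)
    (va : v (a i)%:A = nu (Q i)) (fin_i : nu (Q i) < infty) :
    seg_mod v (alpha Q) :=
  SegMod (alpha_seg_subproof va fin_i).

End KeySequence.

(* Main.v *)
Require Import Defs.
From HB Require Import structures.
From mathcomp Require Import all_boot all_order all_algebra all_field.
From mathcomp Require Import boolp classical_sets wochoice.

Set Implicit Arguments.
Unset Strict Implicit.
Unset Printing Implicit Defensive.

Import Order.TTheory GRing.Theory.
Local Open Scope classical_set_scope.
Local Open Scope ring_scope.

(** The key polynomials enter only through the isomorphism of Omega with
    I_alpha / I_beta: what remains is a statement about two nonempty final
    segments S and T of the value group with infinity, namely that a nonzero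
    quotient I_S / I_T over a valuation ring O is finitely presented if and
    only if S and T have least elements ([finitely_presented_seg_quotP]).

    Divisibility in O is decided by the value ([val_le_dvd]), so the
    submodules I_S are totally ordered by inclusion, and since v is onto, I_S
    determines S as soon as S is nonempty. A submodule I_T spanned by finitely
    many elements y_i is spanned by one of least value, and that value is the
    least element of T
    ([spanned_seg_has_least]). Conversely a least element of S gives a
    generator of I_S ([has_least_generator]).

    Suppose I_S / I_T has a finite presentation with relation matrix A, and
    lift its generators to x_1, ..., x_n in I_S. The quotient is nonzero, so
    some x_j lies outside I_T, and then I_T is contained in O x_j. Hence the
    x_k span I_S, not only I_S modulo I_T. For the same reason every element
    of I_T is a combination of the x_k, and its coefficients lie in the row
    space of A, so I_T is spanned by the combinations of the x_k whose
    coefficients are the rows of A. Both segments therefore have least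
    elements ([finitely_presented_has_least]).

    In the other direction I_S = O x and I_T = O y with x nonzero and
    y = c x, and the quotient is O / c O, presented by the 1 x 1 matrix c
    ([has_least_finitely_presented]). *)

(** * Transport of finite presentations *)

Lemma finitely_presented_iso (R : comNzRingType) (M N : lmodType R)
    (phi : {linear M -> N}) : bijective phi ->
  finitely_presented M <-> finitely_presented N.
Proof.
have transfer (M' N' : lmodType R) (h : {linear M' -> N'}) : bijective h ->
    finitely_presented M' -> finitely_presented N'.
  case=> h' hK h'K [m [n [A [f [f_surj f_ker]]]]].
  exists m, n, A, (h \o f); split=> [w|x /=].
    by have [x fx] := f_surj (h' w); exists x; rewrite /= fx h'K.
  by rewrite -f_ker -{1}(raddf0 h); split=> [/(can_inj hK)|->].
case=> psi phiK psiK; split; first by apply: transfer; exists psi.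
have psi_lin : linear psi := can2_linear phiK psiK.
pose psiL := GRing.isLinear.Build R N M _ psi psi_lin.
pose psi' : {linear N -> M} := HB.pack psi psiL.
by apply: (transfer _ _ psi'); exists phi.
Qed.

(** * Quotients of segment modules over a valuation ring *)

Section SegmentModule.
Variables (L : fieldType) (G : orderedGroupType) (v : valuation L G).
Implicit Types (S T : set (winf G)) (b x y : valmod v) (c : valring v).

Lemma infty_winf_le (s : winf G) : infty <= s -> s = infty.
Proof. by case: s. Qed.

Lemma val_eq_infty b : v b = infty -> b = 0.
Proof.
move=> vb; apply/eqP; apply: contraT => b0.
have := valuationM v (b : L) b^-1; rewrite divff // valuation1 vb.
by case: (v b^-1).
Qed.

Lemma val_le_scale c b : v b <= v (c *: b).
Proof.
rewrite [X in _ <= v X]/(_ * _) valuationM -[leLHS]add0r.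
exact/winf_leD2r/(valringP c).
Qed.

(** In a valuation ring, comparing values decides divisibility: y / x has
    nonnegative value. When x = 0 the value of y is infinite, so y = 0. *)
Lemma val_le_dvd x y : v x <= v y -> exists c, y = c *: x.
Proof.
have [->|x0] := eqVneq x 0.
  rewrite valuation0 => /infty_winf_le/val_eq_infty ->.
  by exists 0; rewrite scale0r.
move=> le_xy.
suff cP : (y : L) / x \in valring_pred v.
  by exists (Valring cP); apply: esym; exact: (divfK x0 (y : L)).
rewrite valring_predP.
have vx : v x + v (x : L)^-1 = 0 by rewrite -valuationM divff ?valuation1.
by rewrite valuationM -vx; apply: winf_leD2r.
Qed.

Lemma val_sum_ge (J : finType) (F : J -> valmod v) s :
  (forall j, s <= v (F j)) -> s <= v (\sum_j F j).
Proof.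
move=> sF; elim/big_ind: _ => [|x y sx sy|//]; first by rewrite valuation0.
by apply: le_trans (valuationD _ _ _); rewrite le_min sx sy.
Qed.

Lemma seg_pred0 S : 0 \in seg_pred v S.
Proof. by apply/seg_predP; left. Qed.

Lemma mem_seg S b s : S s -> s <= v b -> b \in seg_pred v S.
Proof. by move=> Ss sb; apply/seg_predP; right; exists s. Qed.

Lemma seg_up S x y : x \in seg_pred v S -> v x <= v y -> y \in seg_pred v S.
Proof.
move=> Sx /val_le_dvd[c ->]; exact: (rpredZ (c : valring v) Sx).
Qed.

(** Submodules of this form are comparable with every principal submodule:
    an element outside I_S divides all of I_S. *)
Lemma seg_notin_le S x y :
  x \notin seg_pred v S -> y \in seg_pred v S -> v x <= v y.
Proof.
move=> xS yS; have [//|/ltW/(seg_up yS)] := leP (v x) (v y).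
by rewrite (negPf xS).
Qed.

Lemma seg_pi0P S T (b : seg_mod v S) :
  seg_pi T b = 0 <-> seg_val b \in seg_pred v T.
Proof.
rewrite -[0](raddf0 (quotmod_pi (@seg_sub_pred _ _ v S T))).
by split=> [/quotmod_piP|?]; [|apply/quotmod_piP]; rewrite subr0.
Qed.

Lemma seg_quot_neq0 S T (w : seg_quot v S T) : w != 0 ->
  exists2 x, x \in seg_pred v S & x \notin seg_pred v T.
Proof.
have [b <-] := quotmod_pi_surj w => b0; exists (seg_val b).
  exact: seg_valP.
by apply: contra b0 => /(seg_pi0P T b)/eqP.
Qed.

Hypothesis v_onto : forall s : G, exists x : L, v x = fin s.

Lemma val_onto (s : winf G) : exists b, v b = s.
Proof. by case: s => [s|]; [exact: v_onto | exists 0; exact: valuation0]. Qed.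

Definition has_least S := exists s, S s /\ lbound S s.

(** The least element is the minimum of the values of the spanning family,
    infinity if the family is empty. It bounds T below because a combination
    has value at least that of its terms, and every t in T is the value of
    an element of I_T. When I_T = 0 the minimum is infinity, which belongs
    to T only because T is nonempty. *)
Lemma spanned_seg_has_least T m (y : 'I_m -> valmod v) :
  final_segment T -> T !=set0 ->
  (forall i, y i \in seg_pred v T) ->
  (forall b, b \in seg_pred v T ->
     exists r : 'rV[valring v]_m, b = \sum_i r 0 i *: y i) ->
  has_least T.
Proof.
move=> Tfin [t0 Tt0] yT spanT.
have Tinf : T infty by exact: Tfin Tt0 _.
exists (\big[Order.min/infty]_i v (y i)); split.
  elim/big_ind: _ => [//|s t Ts Tt|i _].
    by rewrite /Order.min; case: ifP.
  have /seg_predP[->|[s Ts sy]] := yT i; first by rewrite valuation0.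
  exact: Tfin Ts sy.
move=> t Tt; have [b vb] := val_onto t.
have /spanT[r def_b] : b \in seg_pred v T by apply: mem_seg Tt _; rewrite vb.
rewrite -vb def_b; apply: val_sum_ge => i.
apply: le_trans (val_le_scale (r 0 i) (y i)).
exact: bigmin_le.
Qed.

(** The lifts of the generators span I_S exactly, because one of them already
    divides all of I_T; so the relations among the generators describe I_T
    exactly as well. *)
Lemma finitely_presented_has_least S T :
    final_segment S -> final_segment T -> T !=set0 ->
    (exists w : seg_quot v S T, w != 0) ->
  finitely_presented (seg_quot v S T) -> has_least S /\ has_least T.
Proof.
move=> Sfin Tfin T0 [w0 w0neq] [m [n [A [f [f_surj f_ker]]]]].
have [x fx] := choice (fun j : 'I_n => quotmod_pi_surj (f (delta_mx 0 j))).
pose psi (r : 'rV[valring v]_n) := \sum_j r 0 j *: x j.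
have f_psi r : f r = seg_pi T (psi r).
  rewrite {1}[r]row_sum_delta linear_sum /seg_pi linear_sum.
  by apply: eq_bigr => j _; rewrite !linearZ -fx.
have psi_delta c j : psi (c *: delta_mx 0 j) = c *: x j.
  rewrite /psi (bigD1 j) //= big1 => [|k kj].
    by rewrite !mxE !eqxx mulr1 addr0.
  by rewrite !mxE (negPf kj) mulr0 scale0r.
have [j xjT] : exists j, seg_val (x j) \notin seg_pred v T.
  apply: contrapT => /forallNP xT; case/negP: w0neq.
  have [r <-] := f_surj w0; rewrite f_psi /seg_pi linear_sum big1 // => j _.
  apply/(seg_pi0P T (r 0 j *: x j)).
  apply: (rpredZ (r 0 j : valring v)); apply: contrapT => /negP; exact: xT.
have S0 : S !=set0.
  have /seg_predP[xj0|[s Ss _]] := seg_valP (x j); last by exists s.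
  by rewrite xj0 seg_pred0 in xjT.
have divT t : t \in seg_pred v T -> exists c, t = c *: seg_val (x j).
  by move=> tT; apply: val_le_dvd; exact: seg_notin_le tT.
have valZ c (b : seg_mod v S) : seg_val (c *: b) = c *: seg_val b by [].
have valS (p : nat) (F : 'I_p -> seg_mod v S) :
    seg_val (\sum_i F i) = \sum_i seg_val (F i).
  exact: (raddf_sum (val : seg_mod v S -> valmod v)).
split.
  apply: (@spanned_seg_has_least S n (fun k => seg_val (x k))) => //.
    by move=> k; exact: seg_valP.
  move=> b bS; have [r fr] := f_surj (seg_pi T (SegMod bS)).
  have /divT[c bc] : b - seg_val (psi r) \in seg_pred v T.
    by apply/(quotmod_piP (@seg_sub_pred _ _ v S T) (SegMod bS) (psi r));
       rewrite -[LHS]fr f_psi.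
  (* The error term of the lift lies in I_T, so x_j absorbs it. *)
  exists (r + c *: delta_mx 0 j).
  have -> : b = seg_val (psi r) + seg_val (psi (c *: delta_mx 0 j)).
    by rewrite psi_delta valZ -bc addrC subrK.
  rewrite /psi !valS -big_split; apply: eq_bigr => k _ /=.
  by rewrite [in RHS]mxE scalerDl.
apply: (@spanned_seg_has_least T m (fun i => seg_val (psi (row i A)))) => //.
  move=> i; apply/(seg_pi0P T (psi (row i A))); rewrite -f_psi; apply/f_ker.
  by exists (delta_mx 0 i); rewrite rowE.
(* Written as c x_j, an element of I_T gives a coefficient vector killed by f,
   that is, a combination z of the rows of A. *)
move=> t tT; have [c tc] := divT t tT.
have /f_ker[z cz] : f (c *: delta_mx 0 j) = 0.
  by rewrite f_psi; apply/seg_pi0P; rewrite psi_delta valZ -tc.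
exists z; have -> : t = seg_val (psi (z *m A)) by rewrite -cz psi_delta valZ.
rewrite /psi valS; under eq_bigr do rewrite valZ mxE scaler_suml.
rewrite exchange_big; apply: eq_bigr => i _; rewrite valS scaler_sumr.
by apply: eq_bigr => k _; rewrite valZ mxE scalerA.
Qed.

Lemma has_least_generator S : has_least S ->
  exists2 x, x \in seg_pred v S & forall b, b \in seg_pred v S -> v x <= v b.
Proof.
case=> s [Ss s_min]; have [x vx] := val_onto s.
exists x => [|b /seg_predP[->|[t St tb]]]; first by apply: mem_seg Ss _; rewrite vx.
  by rewrite valuation0.
by rewrite vx; apply: le_trans tb; exact: s_min.
Qed.

(** With I_S = O x and I_T = O y, the quotient is presented by the single
    generator x and the single relation c = y / x. That x is nonzero and that
    c is integral both come from the quotient being nonzero, which keeps x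
    outside I_T. *)
Lemma has_least_finitely_presented S T :
    (exists w : seg_quot v S T, w != 0) ->
  has_least S -> has_least T -> finitely_presented (seg_quot v S T).
Proof.
case=> w0 /seg_quot_neq0[b0 b0S b0T].
case/has_least_generator=> x xS x_min /has_least_generator[y yT y_min].
(* x divides all of I_S, so if it were in I_T then so would be b0. *)
have xT : x \notin seg_pred v T.
  by apply: contra b0T => xT; apply: seg_up xT (x_min _ b0S).
have x0 : x != 0 by apply: contraNneq xT => ->; exact: seg_pred0.
have [c yc] : exists c, y = c *: x by apply: val_le_dvd; exact: seg_notin_le yT.
pose gen := SegMod xS.
pose f (r : 'rV[valring v]_1) : seg_quot v S T := seg_pi T (r 0 0 *: gen).
have f_lin : linear f.
  by move=> d r r'; rewrite /f /seg_pi !mxE scalerDl -scalerA linearD linearZ.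
pose fL := GRing.isLinear.Build (valring v) 'rV[valring v]_1 (seg_quot v S T) _
  f f_lin.
pose f' : {linear 'rV[valring v]_1 -> seg_quot v S T} := HB.pack f fL.
exists 1%N, 1%N, (const_mx c), f'; split=> [w|r] /=.
  have [[b bS] <-] := quotmod_pi_surj w.
  have [d bd] := val_le_dvd (x_min b bS).
  exists (const_mx d); congr (quotmod_pi _ _); apply: val_inj.
  by rewrite /= mxE [RHS]bd.
rewrite (seg_pi0P T (r 0 0 *: gen)) -[seg_val _]/(r 0 0 *: x).
have row1 (d : valring v) :
    (const_mx d : 'rV_1) *m const_mx c = const_mx (d * c) :> 'rV_1.
    by apply/rowP=> k; rewrite !mxE big_ord1 !mxE.
split=> [/y_min/val_le_dvd[d rd]|[z ->]].
  exists (const_mx d); rewrite row1; apply/rowP => k; rewrite mxE ord1.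
  apply: val_inj; apply: (mulIf (x0 : (x : L) != 0)).
  move: rd; rewrite yc scalerA.
  exact.
have -> : z = const_mx (z 0 0) by apply/rowP=> k; rewrite mxE ord1.
rewrite row1 mxE -scalerA -yc; exact: (rpredZ (z 0 0 : valring v) yT).
Qed.

Lemma finitely_presented_seg_quotP S T :
    final_segment S -> final_segment T -> T !=set0 ->
    (exists w : seg_quot v S T, w != 0) ->
  finitely_presented (seg_quot v S T) <-> has_least S /\ has_least T.
Proof.
move=> Sfin Tfin T0 nz; split; first exact: finitely_presented_has_least.
by case=> leastS leastT; apply: has_least_finitely_presented.
Qed.

End SegmentModule.

(** * The final segment generated by a set *)

Lemma smallest_final_segment (G : orderedGroupType) (X : set (winf G)) :
  final_segment (smallest (@final_segment G) X).
Proof.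
move=> s t sS le_st F [Ffin XF]; exact: Ffin (smallest_sub Ffin XF sS) le_st.
Qed.

Lemma smallest_final_segment_neq0 (G : orderedGroupType) (J : Type)
    (h : J -> winf G) (j : J) :
  smallest (@final_segment G) (range h) !=set0.
Proof. by exists (h j); apply: sub_gen_smallest; exists j. Qed.

Theorem corollary4p9
  (* the valued field extension L = K(eta), with vL = vK = G *)
  (G : orderedGroupType) (K : fieldType) (L : fieldExtType K)
  (v : valuation L G)
  (v_onto : forall c : G, exists x : L, v x = fin c)
  (vL_vK : forall x : L, x != 0 -> exists c : K, v c%:A = v x)
  (eta : L) (L_simple : <<1; eta>>%VS = fullv)
  (g : {poly K}) (g_min : map_poly (in_alg L) g = minPoly 1 eta)
  (* the extension of nu to the polynomials over an algebraic closure of K,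
     with values in an ordered group containing G *)
  (Kbar : closedFieldType) (iota : {rmorphism K -> Kbar})
  (Kbar_alg : forall z : Kbar, algebraicOver iota z)
  (G' : orderedGroupType) (emb : {additive G -> G'})
  (emb_mono : {mono emb : c d / c <= d})
  (nubar : valuation {poly Kbar} G')
  (nubar_ext : forall f : {poly K},
     nubar (map_poly iota f) = winf_map emb (nu v eta f))
  (* the complete sequence of key polynomials *)
  (disp : Order.disp_t) (I : orderType disp)
  (I_wo : well_order (<=%O : rel I))
  (i0 : I) (i0_min : forall i : I, (i0 <= i)%O)
  (Q : I -> {poly K})
  (Q_key : forall q, (range Q `|` [set g]) q -> key_polynomial iota nubar q)
  (Q_complete : complete_set (nu v eta) (range Q `|` [set g]))
  (Q_delta : forall i j : I,
     (i < j)%O -> delta iota nubar (Q i) < delta iota nubar (Q j))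
  (Q_fin : forall i, nu v eta (Q i) < infty)
  (Q_0 : Q i0 = 'X) (nu_X : nu v eta 'X = 0)
  (a : I -> K) (va : forall i, v (a i)%:A = nu v eta (Q i)) (a_0 : a i0 = 1)
  (* the homomorphism from Omega to I_alpha / I_beta *)
  (Omega_iso :
     exists phi : {linear Omega v ->
                     seg_quot v (alpha v eta Q) (beta v eta Q g)},
       bijective phi /\
       forall i, phi (Omega_d (key_elt (va i) (Q_fin i)))
                 = seg_pi (beta v eta Q g) (key_deriv_elt (va i) (Q_fin i)))
  (Omega_neq0 : exists w : Omega v, w != 0) :
  finitely_presented (Omega v) <->
  (exists s, alpha v eta Q s /\ lbound (alpha v eta Q) s) /\
  (exists s, beta v eta Q g s /\ lbound (beta v eta Q g) s).
Proof.
have [phi [phi_bij _]] := Omega_iso.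
rewrite (finitely_presented_iso phi_bij).
apply: finitely_presented_seg_quotP => //.
- exact: smallest_final_segment.
- exact: smallest_final_segment.
- exact: smallest_final_segment_neq0 i0.
have [w w0] := Omega_neq0; exists (phi w).
by rewrite -(raddf0 phi) (inj_eq (bij_inj phi_bij)).
Qed.
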